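(* Let $(\Gamma,E)$ be a generalised Cartan lattice and consider the map $F\mapsto s_F$ from real exceptional sequences in $(\Gamma,E)$ to the Weyl group $W(\Gamma,E)$. Then the image of this map is precisely $\mathrm{NC}(\Gamma,E)$, and for real exceptional sequences $F,F'$ one has $s_F=s_{F'}$ if and only if $\mathbb ZF=\mathbb ZF'$.
   Context: A bilinear lattice is an abelian group $\Gamma$ with a non-degenerate bilinear form $\langle-,-\rangle\colon\Gamma\times\Gamma\to\mathbb Z$ (i.e. $\langle x,-\rangle=0$ implies $x=0$, and $\langle-,y\rangle=0$ implies $y=0$); its symmetrised form is $(x,y)=\langle x,y\rangle+\langle y,x\rangle$. A root is $a\in\Gamma$ with $\langle a,a\rangle>0$ and $\frac{\langle a,x\rangle}{\langle a,a\rangle},\frac{\langle x,a\rangle}{\langle a,a\rangle}\in\mathbb Z$ for all $x\in\Gamma$; it defines the reflection $s_a(x)=x-2\frac{(x,a)}{(a,a)}a$. An exceptional sequence of length $r$ is a sequence of roots $F=(f_1,\dots,f_r)$ with $\langle f_i,f_j\rangle=0$ for $i>j$ (the empty sequence is allowed); $\mathbb ZF$ is the subgroup of $\Gamma$ generated by the $f_i$; $F$ is complete if $\mathbb ZF=\Gamma$, and orthogonal if $\langle f_i,f_j\rangle\le0$ for all $i\ne j$. Write $s_F=s_{f_1}\cdots s_{f_r}$. A generalised Cartan lattice $(\Gamma,E)$ is a bilinear lattice $\Gamma$ with a complete orthogonal exceptional sequence $E=(e_1,\dots,e_n)$. Its Weyl group $W(\Gamma,E)$ is the subgroup generated by $s_{e_1},\dots,s_{e_n}$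 in the group of automorphisms of $\Gamma$ preserving the symmetrised form. Its real roots are $\Phi=\{w(e_i)\mid w\in W(\Gamma,E),1\le i\le n\}$ and its reflections are the $s_a$, $a\in\Phi$. The absolute length $\ell(w)$ is the minimal number of reflections whose product is $w$; $u\le v$ iff $\ell(u)+\ell(u^{-1}v)=\ell(v)$; and $\mathrm{NC}(\Gamma,E)=\{w\in W(\Gamma,E)\mid\mathrm{id}\le w\le s_E\}$. A real exceptional sequence in $(\Gamma,E)$ is a subsequence of a complete exceptional sequence $(f_1,\dots,f_n)$ in $\Gamma$ with every $f_i\in\Phi$. *)

(* Defs.v *)
From HB Require Import structures.
From mathcomp Require Import all_boot all_order all_algebra all_fingroup.
From mathcomp Require Import boolp classical_sets.

Set Implicit Arguments.
Unset Strict Implicit.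
Unset Printing Implicit Defensive.

Import Order.TTheory GRing.Theory Num.Theory.

Local Open Scope classical_set_scope.
Local Open Scope ring_scope.

HB.mixin Record isBilinearLattice G of GRing.Zmodule G := {
  bform : G -> G -> int;
  bform_is_additivel : forall y, zmod_morphism (bform^~ y);
  bform_is_additiver : forall x, zmod_morphism (bform x);
  bform_nondegl : forall x, (forall y, bform x y = 0) -> x = 0;
  bform_nondegr : forall y, (forall x, bform x y = 0) -> y = 0 }.

#[short(type="bilinLatticeType")]
HB.structure Definition BilinearLattice :=
  {G of isBilinearLattice G & GRing.Zmodule G}.

Section BilinearLatticeTheory.
Variable G : bilinLatticeType.
Implicit Types (a x y : G).

Definition symform x y : int := bform x y + bform y x.

Definition is_root a : Prop :=
  0 < bform a a /\
  forall x, (bform a a %| bform a x)%Z /\ (bform a a %| bform x a)%Z.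

Record lattice_root :=
  LatticeRoot { root_val :> G; _ : `[< is_root root_val >] }.
HB.instance Definition _ := [isSub for root_val].
HB.instance Definition _ := [Choice of lattice_root by <:].

Lemma lattice_rootP (a : lattice_root) : is_root a.
Proof. by case: a => a /= /asboolP. Qed.

(* For a root a the integer division is exact, cf. [symform_dvd]. *)
Definition reflection_fun (a : lattice_root) x : G :=
  x - root_val a *~ (2 * symform x a %/ symform a a)%Z.

(* The inverse is part of the data, but it is determined by the underlying
   function, cf. [symaut_eq]. *)
Record symaut := SymAut {
  symaut_fun :> G -> G;
  symaut_inv : G -> G;
  _ : cancel symaut_fun symaut_inv;
  _ : cancel symaut_inv symaut_fun;
  _ : zmod_morphism symaut_fun;
  _ : forall x y, symform (symaut_fun x) (symaut_fun y) = symform x y }.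

Lemma symautK (u : symaut) : cancel u (symaut_inv u). Proof. by case: u. Qed.
Lemma symautKV (u : symaut) : cancel (symaut_inv u) u. Proof. by case: u. Qed.
Lemma symautB (u : symaut) : zmod_morphism u. Proof. by case: u. Qed.
Lemma symaut_sym (u : symaut) x y : symform (u x) (u y) = symform x y.
Proof. by case: u. Qed.

Lemma symaut_eq (u v : symaut) : u =1 v -> u = v.
Proof.
move=> uv; have: symaut_inv u =1 symaut_inv v.
  by move=> x; rewrite -{1}(symautKV v x) -uv symautK.
case: u v uv => [f f' ? ? ? ?] [g g' ? ? ? ?] /= /funext fg /funext fg'.
by subst g g'; congr SymAut; apply: Prop_irrelevance.
Qed.

Definition symaut1 : symaut.
Proof. by exists id id. Defined.

Definition symautM (u v : symaut) : symaut.
Proof.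
exists (u \o v) (symaut_inv v \o symaut_inv u).
- by move=> x /=; rewrite !symautK.
- by move=> x /=; rewrite !symautKV.
- by move=> x y /=; rewrite !symautB.
- by move=> x y /=; rewrite !symaut_sym.
Defined.

Definition symautV (u : symaut) : symaut.
Proof.
exists (symaut_inv u) u.
- exact: symautKV.
- exact: symautK.
- by move=> x y; apply: (can_inj (symautK u)); rewrite symautB !symautKV.
- by move=> x y; rewrite -(symaut_sym u) !symautKV.
Defined.

HB.instance Definition _ := gen_eqMixin symaut.
HB.instance Definition _ := gen_choiceMixin symaut.

Lemma symautMA : associative symautM.
Proof. by move=> u v w; apply: symaut_eq. Qed.
Lemma symaut1M : left_id symaut1 symautM.
Proof. by move=> u; apply: symaut_eq. Qed.
Lemma symautM1 : right_id symaut1 symautM.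
Proof. by move=> u; apply: symaut_eq. Qed.
Lemma symautVM : left_inverse symaut1 symautV symautM.
Proof. by move=> u; apply: symaut_eq => x; apply: symautK. Qed.
Lemma symautMV : right_inverse symaut1 symautV symautM.
Proof. by move=> u; apply: symaut_eq => x; apply: symautKV. Qed.

HB.instance Definition _ :=
  isGroup.Build symaut symautMA symaut1M symautM1 symautVM symautMV.

Lemma symaut_mulE (u v : symaut) x : (u * v)%g x = u (v x).
Proof. by []. Qed.

Lemma symformC x y : symform x y = symform y x.
Proof. by rewrite /symform addrC. Qed.

Lemma symformBl y : zmod_morphism (symform^~ y).
Proof.
move=> x z; rewrite /symform bform_is_additivel bform_is_additiver.
by rewrite opprD addrACA.
Qed.

Lemma symformMzl x y k : symform (x *~ k) y = symform x y * k.
Proof.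
pose h := GRing.isZmodMorphism.Build G int (symform^~ y) (symformBl y).
pose f : {additive G -> int} := HB.pack (symform^~ y) h.
by rewrite -[LHS]/(f _) raddfMz mulrzz.
Qed.

Lemma symform_root_gt0 (a : lattice_root) : 0 < symform a a.
Proof. by have [a0 _] := lattice_rootP a; rewrite addr_gt0. Qed.

Lemma symform_dvd (a : lattice_root) x : (symform a a %| 2 * symform x a)%Z.
Proof.
have [_ /(_ x)[ax xa]] := lattice_rootP a.
have -> : symform a a = 2 * bform a a by rewrite /symform mulrDl mul1r.
by apply: dvdz_mul => //; rewrite /symform rpredD.
Qed.

Lemma reflection_coefK (a : lattice_root) x :
  (2 * symform x a %/ symform a a)%Z * symform a a = 2 * symform x a.
Proof. exact/divzK/symform_dvd. Qed.

Lemma symform_reflection_root (a : lattice_root) x :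
  symform (reflection_fun a x) a = - symform x a.
Proof.
rewrite /reflection_fun symformBl symformMzl mulrC reflection_coefK.
by rewrite [2 * _]mulrDl mul1r opprD addrA subrr sub0r.
Qed.

Lemma reflection_funK (a : lattice_root) : involutive (reflection_fun a).
Proof.
move=> x; rewrite {1}/reflection_fun symform_reflection_root mulrN.
have a0 : symform a a != 0 by rewrite gt_eqF ?symform_root_gt0.
rewrite -reflection_coefK -mulNr mulzK // mulrNz opprK.
by rewrite /reflection_fun subrK.
Qed.

Lemma reflection_funB (a : lattice_root) : zmod_morphism (reflection_fun a).
Proof.
move=> x y; rewrite /reflection_fun symformBl.
have a0 : symform a a != 0 by rewrite gt_eqF ?symform_root_gt0.
have -> : (2 * (symform x a - symform y a) %/ symform a a)%Z
    = (2 * symform x a %/ symform a a)%Z - (2 * symform y a %/ symform a a)%Z.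
  rewrite mulrBr -(reflection_coefK a x) -(reflection_coefK a y).
  by rewrite -mulrBl !mulzK.
by rewrite mulrzBr !opprB addrACA [in RHS]addrACA [- y + _]addrC.
Qed.

Lemma symform_reflection (a : lattice_root) x y :
  symform (reflection_fun a x) (reflection_fun a y) = symform x y.
Proof.
have a0 : symform a a != 0 by rewrite gt_eqF ?symform_root_gt0.
have e z : symform (reflection_fun a x) z
    = symform x z - symform a z * (2 * symform x a %/ symform a a)%Z.
  by rewrite {1}/reflection_fun symformBl symformMzl.
rewrite symformC {1}/reflection_fun symformBl symformMzl.
rewrite (symformC y) (symformC a) symform_reflection_root e mulNr opprK.
suff -> : symform a y * (2 * symform x a %/ symform a a)%Z
    = symform x a * (2 * symform y a %/ symform a a)%Z by rewrite subrK.
apply: (mulIf a0); rewrite -!mulrA !reflection_coefK (symformC a y).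
by rewrite mulrCA [RHS]mulrCA [symform y a * _]mulrC.
Qed.

Definition reflection (a : lattice_root) : symaut :=
  SymAut (reflection_funK a) (reflection_funK a) (reflection_funB a)
         (symform_reflection a).

Lemma bformMzl x y k : bform (x *~ k) y = bform x y * k.
Proof.
pose h := GRing.isZmodMorphism.Build G int (bform^~ y) (bform_is_additivel y).
pose f : {additive G -> int} := HB.pack (bform^~ y) h.
by rewrite -[LHS]/(f _) raddfMz mulrzz.
Qed.

Lemma bformMzr x y k : bform x (y *~ k) = bform x y * k.
Proof.
pose h := GRing.isZmodMorphism.Build G int (bform x) (bform_is_additiver x).
pose f : {additive G -> int} := HB.pack (bform x) h.
by rewrite -[LHS]/(f _) raddfMz mulrzz.
Qed.

Lemma bform_symaut (u : symaut) x : bform (u x) (u x) = bform x x.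
Proof.
have e := symaut_sym u x x; rewrite /symform -!mulr2n in e.
by apply: (@pmulrnI _ 2%N).
Qed.

Lemma is_root_reflection (b : lattice_root) a :
  is_root a -> is_root (reflection b a).
Proof.
move=> [a0 aP]; split=> [|x]; rewrite !bform_symaut // /=.
have [b0 /(_ x)[bx xb]] := lattice_rootP b.
have ab : (bform a a %| symform a b)%Z by rewrite rpredD //; case: (aP b).
have [ax xa] := aP x.
have cP z : (bform b b %| z)%Z ->
    (bform a a %| z * (2 * symform a b %/ symform b b)%Z)%Z.
  move=> /dvdzP[q ->]; rewrite -mulrA; apply: dvdz_mull.
  have -> : bform b b * (2 * symform a b %/ symform b b)%Z = symform a b => //.
  apply: (@mulfI _ 2) => //; rewrite mulrA -[RHS](reflection_coefK b a) [RHS]mulrC.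
  by congr (_ * _); rewrite /symform mulrDl mul1r.
by rewrite bform_is_additivel bform_is_additiver bformMzl bformMzr !rpredB ?cP.
Qed.

Definition reflection_seq (F : seq lattice_root) : symaut :=
  (\prod_(f <- F) reflection f)%g.

(* In [pairwise r F], r is applied to f_i, f_j in this order for i < j. *)
Definition exceptional_seq (F : seq lattice_root) : Prop :=
  pairwise (fun f g : lattice_root => bform g f == 0) F.

Definition orthogonal_seq (F : seq lattice_root) : Prop :=
  pairwise (fun f g : lattice_root => (bform f g <= 0) && (bform g f <= 0)) F.

Definition is_zsubgroup (A : set G) : Prop :=
  A 0 /\ forall x y, A x -> A y -> A (x - y).

Definition zspan (F : seq lattice_root) : set G :=
  smallest is_zsubgroup [set root_val f | f in [set` F]].

Definition complete_seq (F : seq lattice_root) : Prop := zspan F = setT.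

Definition generalised_Cartan (n : nat) (E : n.-tuple lattice_root) : Prop :=
  [/\ exceptional_seq E, complete_seq E & orthogonal_seq E].

Definition is_subgroup (H : set symaut) : Prop :=
  [/\ H 1%g, forall u v, H u -> H v -> H (u * v)%g
    & forall u, H u -> H (u^-1)%g].

Section CartanLattice.
Variables (n : nat) (E : n.-tuple lattice_root).

Definition Weyl_group : set symaut :=
  smallest is_subgroup [set reflection e | e in [set` E]].

Definition real_roots : set G :=
  [set x | exists w i, Weyl_group w /\ x = w (tnth E i)].

Lemma real_roots_is_root x : real_roots x -> is_root x.
Proof.
move=> [w [i [Ww ->]]].
pose H : set symaut := [set u | forall y, is_root (u y) <-> is_root y].
suff /(_ (tnth E i))[_] : H w by apply; apply: lattice_rootP.
apply: Ww; split; first split=> [y //|u v Hu Hv y|u Hu y].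
- by rewrite symaut_mulE; split=> [/Hu/Hv|/Hv/Hu].
- by rewrite -{2}(symautKV u y); split=> /Hu.
move=> _ [b _ <-] y; split=> [/(is_root_reflection b)|/is_root_reflection] //.
by rewrite /= reflection_funK.
Qed.

(* By [real_roots_is_root], letting a range over the type [lattice_root] loses
   nothing. *)
Definition real_reflections : set symaut :=
  [set reflection a | a in [set a : lattice_root | real_roots a]].

Definition product_of_reflections (w : symaut) (k : nat) : Prop :=
  exists2 t : k.-tuple symaut,
    (forall i, real_reflections (tnth t i)) & w = (\prod_(g <- t) g)%g.

(* The default value 0 is never used for elements of [Weyl_group]. *)
Definition abs_length (w : symaut) : nat :=
  match pselect (exists k, `[< product_of_reflections w k >]) with
  | left ex => ex_minn ex
  | right _ => 0
  end.

Definition abs_le (u v : symaut) : Prop :=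
  (abs_length u + abs_length (u^-1 * v)%g = abs_length v)%N.

Definition NC : set symaut :=
  [set w | [/\ Weyl_group w, abs_le 1%g w & abs_le w (reflection_seq E)]].

Definition real_exceptional (F : seq lattice_root) : Prop :=
  exists C : n.-tuple lattice_root,
    [/\ exceptional_seq C, complete_seq C,
        forall i, real_roots (tnth C i) & subseq F C].

End CartanLattice.

End BilinearLatticeTheory.

(* Main.v *)
From HB Require Import structures.
Require Import Defs.
From mathcomp Require Import all_boot all_order all_algebra all_fingroup.
From mathcomp Require Import boolp classical_sets.
From mathcomp Require Import zify ring.

(* Let c = s_E. For a root a put [pr z a] = <a, z> / <a, a>. A product of
   reflections s_{a_1} ... s_{a_r} has a displacement cocycle
     D_{a_1 ... a_r}(z) = s_{a_1} (D_{a_2 ... a_r}(z)) + pr z a_1 . a_1,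
   which is the displacement of the functional <-, z> in the representation of
   the Weyl group on the lattice extended by its dual; it lies in the span of
   the a_i.  If F is exceptional, then D_F is the projection onto ZF along the
   right orthogonal of F, so ZF = {z | D_F z = z}, and D_E is the identity.

   The crux is that for real roots the cocycle depends only on the product of
   the reflections.  Expanding real reflections as words in the s_{e_i}, this
   amounts to D_w = 0 for every word w in the e_i whose product is trivial.  In
   that case D_w(z) lies in the radical and, comparing norms, is orthogonal to
   <-, z>; if <e_i, z> > 0 for all i then D_w(z) is a nonnegative combination of
   the e_i by the usual Coxeter-theoretic positivity, so it vanishes.  Such z
   generate the lattice.

   Consequently a factorisation of c into real reflections s_{a_1} ... s_{a_k}
   satisfies D(z) = z for all z, so that the a_i generate the lattice and
   k >= n; when k = n they are independent, and D = id then forces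
   <a_j, a_i> = 0 for i < j.  Thus c has absolute length n and its minimal
   factorisations are exactly the complete real exceptional sequences. *)

Local Open Scope classical_set_scope.

Section NonCrossing.
Set Implicit Arguments.
Unset Strict Implicit.
Unset Printing Implicit Defensive.
Import Order.TTheory GRing.Theory Num.Theory.
Local Open Scope ring_scope.

(** * Form calculus, reflections and the displacement cocycle *)

Section Forms.
Context {G : bilinLatticeType}.
Implicit Types (a f : lattice_root G) (x y z : G) (F L : seq (lattice_root G)).
Implicit Types (k : lattice_root G -> int) (u : symaut G).

Lemma bformBl x y z : bform (x - y) z = bform x z - bform y z.
Proof. exact: bform_is_additivel. Qed.

Lemma bformBr x y z : bform x (y - z) = bform x y - bform x z.
Proof. exact: bform_is_additiver. Qed.

Lemma bform0l y : bform (0 : G) y = 0.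
Proof. by rewrite -(subrr y) bformBl subrr. Qed.

Lemma bform0r x : bform x (0 : G) = 0.
Proof. by rewrite -(subrr x) bformBr subrr. Qed.

Lemma bformDl x y z : bform (x + y) z = bform x z + bform y z.
Proof. by have := bformBl x (0 - y) z; rewrite (bformBl 0) bform0l !sub0r !opprK. Qed.

Lemma bformDr x y z : bform x (y + z) = bform x y + bform x z.
Proof.
by have := bformBr x y (0 - z); rewrite (bformBr _ 0) bform0r !sub0r !opprK.
Qed.

Lemma symformDl x y z : symform (x + y) z = symform x z + symform y z.
Proof. by rewrite /symform bformDl bformDr addrACA. Qed.

Lemma symformDr x y z : symform x (y + z) = symform x y + symform x z.
Proof. by rewrite symformC symformDl !(symformC _ x). Qed.

Lemma symformMzr x y m : symform x (y *~ m) = symform x y * m.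
Proof. by rewrite symformC symformMzl symformC. Qed.

Lemma symaut0 u : u 0 = 0.
Proof. by rewrite -{1}(subrr 0) symautB subrr. Qed.

Lemma symautD u x y : u (x + y) = u x + u y.
Proof.
by have := symautB u x (0 - y); rewrite (symautB _ 0) symaut0 !sub0r !opprK.
Qed.

Lemma symautMz u x m : u (x *~ m) = u x *~ m.
Proof.
pose h := GRing.isZmodMorphism.Build G G u (symautB u).
pose f : {additive G -> G} := HB.pack (symaut_fun u) h.
by rewrite -[LHS]/(f _) raddfMz.
Qed.

(** The coroot of [a] evaluated at x. Both divisions are exact because [a] is a root; [cfK] and
    [prK] undo them. *)
Definition cf a x : int := (2 * symform x a %/ symform a a)%Z.
Definition pr z a : int := (bform a z %/ bform a a)%Z.

#[local] Arguments reflection : simpl never.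

Lemma reflectionE a x : reflection a x = x - root_val a *~ cf a x.
Proof. by []. Qed.

Lemma bform_root_gt0 a : 0 < bform a a.
Proof. by have [] := lattice_rootP a. Qed.

Lemma bform_root_neq0 a : bform a a != 0.
Proof. by rewrite gt_eqF ?bform_root_gt0. Qed.

Lemma cfK a x : bform a a * cf a x = symform x a.
Proof.
apply: (@mulfI _ (2 : int)) => //; rewrite -reflection_coefK -/(cf a x).
by rewrite /symform; lia.
Qed.

Lemma prK a z : bform a a * pr z a = bform a z.
Proof. by rewrite mulrC divzK //; case: (lattice_rootP a) => _ /(_ z)[]. Qed.

Lemma cfP a x m : symform x a = bform a a * m -> cf a x = m.
Proof. by move=> e; apply: (mulfI (bform_root_neq0 a)); rewrite cfK. Qed.

Lemma prP a z m : bform a z = bform a a * m -> pr z a = m.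
Proof. by move=> e; apply: (mulfI (bform_root_neq0 a)); rewrite prK. Qed.

Lemma cfD a x y : cf a (x + y) = cf a x + cf a y.
Proof. by apply: cfP; rewrite symformDl -!cfK mulrDr. Qed.

Lemma cfMz a x m : cf a (x *~ m) = cf a x * m.
Proof. by apply: cfP; rewrite symformMzl -!cfK mulrA. Qed.

Lemma cf_root a : cf a a = 2.
Proof. by apply: cfP; rewrite /symform; lia. Qed.

Lemma reflection_root a : reflection a a = - root_val a.
Proof.
rewrite reflectionE cf_root -[X in _ - X]/(root_val a *+ 2) mulr2n.
by rewrite opprD addrA subrr sub0r.
Qed.

Lemma reflectionK a : involutive (reflection a).
Proof. exact: reflection_funK. Qed.

Lemma cf0 a : cf a 0 = 0.
Proof. by apply: cfP; rewrite /symform bform0l bform0r mulr0. Qed.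

Lemma prD a y z : pr (y + z) a = pr y a + pr z a.
Proof. by apply: prP; rewrite bformDr mulrDr !prK. Qed.

Lemma prB a y z : pr (y - z) a = pr y a - pr z a.
Proof. by apply: prP; rewrite bformBr mulrBr !prK. Qed.

Lemma pr_root a : pr a a = 1.
Proof. by apply: prP; rewrite mulr1. Qed.

(* For [k = pr z], a vector [x] stands for the element [bform^~ z - x] of the
   lattice extended by its dual, on which the reflections act linearly. *)
Definition affact k L x : G :=
  foldr (fun a y => reflection a y + root_val a *~ k a) x L.

Lemma affact_nil k x : affact k [::] x = x.
Proof. by []. Qed.

Lemma affact_cons k a L x :
  affact k (a :: L) x = reflection a (affact k L x) + root_val a *~ k a.
Proof. by []. Qed.

Lemma affact_consE k a L x :
  affact k (a :: L) x = affact k L x + root_val a *~ (k a - cf a (affact k L x)).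
Proof. by rewrite affact_cons reflectionE mulrzBr addrA addrAC. Qed.

Lemma affact_cat k L1 L2 x : affact k (L1 ++ L2) x = affact k L1 (affact k L2 x).
Proof. exact: foldr_cat. Qed.

Lemma reflection_seq_cons a L :
  reflection_seq (a :: L) = (reflection a * reflection_seq L)%g.
Proof. exact: big_cons. Qed.

Lemma reflection_seq_cat L1 L2 :
  reflection_seq (L1 ++ L2) = (reflection_seq L1 * reflection_seq L2)%g.
Proof. exact: big_cat. Qed.

Lemma reflection_invg a : (reflection a)^-1%g = reflection a.
Proof. exact: symaut_eq. Qed.

Lemma reflection_seq_rev L : reflection_seq (rev L) = (reflection_seq L)^-1%g.
Proof.
elim: L => [|a L IH]; first by rewrite /reflection_seq !big_nil invg1.
rewrite rev_cons -cats1 reflection_seq_cat IH (reflection_seq_cons a L) invgM.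
by rewrite reflection_invg /reflection_seq big_seq1.
Qed.

Lemma affactD k L x y : affact k L (x + y) = affact k L x + reflection_seq L y.
Proof.
elim: L => [|a L IH]; first by rewrite /reflection_seq big_nil.
rewrite !affact_cons ?IH.
by rewrite symautD reflection_seq_cons symaut_mulE addrAC.
Qed.

Lemma affact_const0 L x : affact (fun=> 0) L x = reflection_seq L x.
Proof.
elim: L => [|a L IH]; first by rewrite /reflection_seq big_nil.
rewrite !affact_cons ?IH.
by rewrite mulr0z addr0 reflection_seq_cons.
Qed.

(** Each letter is an affine involution: the reflection negates the translation by k(a) a, and the
    second translation cancels it. *)
Lemma affact_revK k L x : affact k (rev L) (affact k L x) = x.
Proof.
elim: L x => [//|a L IH] x; rewrite rev_cons -cats1 affact_cat -[RHS]IH.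
congr affact; rewrite 2!affact_cons symautD symautMz reflection_root reflectionK.
by rewrite mulNrz subrK.
Qed.

(** For [k = cf^~ x] a letter sends x - y to x - s_a(y), so the word carries 0 = x - x to the
    displacement of x. *)
Lemma affact_Kcf L x : affact (cf^~ x) L 0 = x - reflection_seq L x.
Proof.
elim: L => [|a L IH]; first by rewrite /reflection_seq big_nil /= subrr.
rewrite !affact_cons ?IH.
rewrite symautB reflection_seq_cons symaut_mulE reflectionE.
by rewrite addrAC subrK.
Qed.

Lemma affactBk k1 k2 L :
  affact (fun a => k1 a - k2 a) L 0 = affact k1 L 0 - affact k2 L 0.
Proof.
elim: L => [|a L IH]; first by rewrite !affact_nil subr0.
rewrite !affact_cons ?IH.
by rewrite symautB mulrzBr (opprD (reflection a _)) addrACA.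
Qed.

Lemma eq_in_affact k1 k2 L x : {in L, k1 =1 k2} -> affact k1 L x = affact k2 L x.
Proof.
elim: L => [//|a L IH] e; rewrite !affact_cons IH ?e ?mem_head // => f fL.
by rewrite e // in_cons fL orbT.
Qed.

(** * Spans of roots and exceptional sequences *)

Lemma zspan_zsubgroup F : is_zsubgroup (zspan F).
Proof.
split=> [A [[A0 _] _] //|x y Fx Fy A hA].
by have [[_ AB] _] := hA; apply: AB; [apply: Fx | apply: Fy].
Qed.

Lemma zspan_root F f : f \in F -> zspan F f.
Proof. by move=> fF A [_]; apply; exists f. Qed.

Lemma zspan_sub F (A : set G) :
  is_zsubgroup A -> (forall f, f \in F -> A f) -> zspan F `<=` A.
Proof. by move=> hA FA x; apply; split=> // _ [f /= /FA ? <-]. Qed.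

Section Zsubgroup.
Variables (A : set G) (hA : is_zsubgroup A).

Lemma zsubgroupN x : A x -> A (- x).
Proof. by case: hA => A0 AB Ax; rewrite -sub0r; apply: AB. Qed.

Lemma zsubgroupD x y : A x -> A y -> A (x + y).
Proof.
by case: (hA) => _ AB Ax Ay; rewrite -(opprK y); apply/AB/zsubgroupN.
Qed.

Lemma zsubgroupMz x m : A x -> A (x *~ m).
Proof.
move=> Ax; have nat_case j : A (x *+ j).
  elim: j => [|j IH]; first by case: hA.
  by rewrite mulrS; apply: zsubgroupD.
by case: m => j; [apply: nat_case | apply/zsubgroupN/nat_case].
Qed.

End Zsubgroup.

Lemma zspan_mono F L : {subset F <= L} -> zspan F `<=` zspan L.
Proof.
move=> FL; apply: zspan_sub => [|f /FL]; first exact: zspan_zsubgroup.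
exact: zspan_root.
Qed.

Lemma affact_zspan k F : zspan F (affact k F 0).
Proof.
elim: F => [|a F IH]; first by case: (zspan_zsubgroup [::]).
rewrite affact_consE; apply: (zsubgroupD (zspan_zsubgroup _)).
  by apply: zspan_mono IH => f fF; rewrite in_cons fF orbT.
by apply: (zsubgroupMz (zspan_zsubgroup _)); apply: zspan_root; apply: mem_head.
Qed.

Lemma exceptional_cons a F : exceptional_seq (a :: F) <->
  (forall f, f \in F -> bform f a = 0) /\ exceptional_seq F.
Proof.
rewrite /exceptional_seq pairwise_cons; split=> [/andP[/allP h ->]|[h ->]].
  by split=> // f /h/eqP.
by rewrite andbT; apply/allP => f /h ->.
Qed.

Lemma zspan_bform0 F x y : (forall f, f \in F -> bform f y = 0) ->
  zspan F x -> bform x y = 0.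
Proof.
move=> h; move: x; apply: zspan_sub => //; split=> [|x x' /= hx hx'].
  exact: bform0l.
by rewrite bformBl hx hx' subrr.
Qed.

(** At the head [a] the tail value y has <y, a> = 0, so subtracting (y, a) cancels <a, y>. For f in
    the tail, the added multiple of [a] is invisible since <f, a> = 0. *)
Lemma bform_affact_exceptional k F f :
  exceptional_seq F -> f \in F -> bform f (affact k F 0) = bform f f * k f.
Proof.
elim: F => [//|a F IH] /exceptional_cons[Fa hF].
rewrite affact_consE bformDr bformMzr in_cons => /predU1P[->|fF].
  rewrite mulrBr cfK /symform (zspan_bform0 _ (@affact_zspan k F)) //.
  by ring.
by rewrite (Fa f fF) mul0r addr0 IH.
Qed.

(** The left side is additive in z, so z may be a member f of [F]. If f is the head, all
    coefficients on the tail vanish; if f is in the tail, <f, a> = 0 makes [pr f a] and [cf a f]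
    equal and the head adds nothing. *)
Lemma affact_pr_exceptional F z :
  exceptional_seq F -> zspan F z -> affact (pr z) F 0 = z.
Proof.
move=> hF; move: z; apply: zspan_sub => [|f].
  split=> [|x y /= hx hy].
    rewrite -[RHS](symaut0 (reflection_seq F)) -affact_const0.
    by apply: eq_in_affact => a _; rewrite /pr bform0r div0z.
  by rewrite -{2}hx -{2}hy -affactBk; apply: eq_in_affact => a _; rewrite prB.
elim: F hF => [//|a F IH] /exceptional_cons[Fa hF].
rewrite in_cons affact_consE => /predU1P[->|fF].
  have -> : affact (pr a) F 0 = 0.
    rewrite -[RHS](symaut0 (reflection_seq F)) -affact_const0.
    by apply: eq_in_affact => g gF; apply: prP; rewrite Fa ?mulr0.
  by rewrite cf0 subr0 pr_root add0r.
rewrite IH // (_ : _ - _ = 0) ?mulr0z ?addr0 //.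
apply: (mulfI (bform_root_neq0 a)).
by rewrite mulrBr prK cfK /symform Fa // add0r subrr mulr0.
Qed.

(** The displacement x - s_F(x) is the only y in ZF with <f, y> = (x, f) for all f in ZF, a
    condition on the span alone. Uniqueness holds because an element of ZF right orthogonal to [F]
    equals its own projection, which is zero. *)
Lemma exceptional_zspan_eq F1 F2 :
    exceptional_seq F1 -> exceptional_seq F2 -> zspan F1 = zspan F2 ->
  reflection_seq F1 = reflection_seq F2.
Proof.
move=> h1 h2 e12; apply: symaut_eq => x; apply: (@addrI _ (- x)).
apply: oppr_inj; rewrite !opprD !opprK -!affact_Kcf; apply/eqP; rewrite -subr_eq0.
set y := _ - _; have F1y : zspan F1 y.
  apply: (zspan_zsubgroup F1).2; first exact: affact_zspan.
  by rewrite e12; apply: affact_zspan.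
have key F f : exceptional_seq F -> zspan F f ->
    bform f (affact (cf^~ x) F 0) = symform x f.
  move=> hF; move: f.
  apply: (@zspan_sub F [set f | bform f (affact (cf^~ x) F 0) = symform x f]).
    split=> [|f g /= ef eg].
      by rewrite /= bform0l /symform bform0l bform0r.
    by rewrite bformBl ef eg !(symformC x) symformBl.
  by move=> f fF /=; rewrite bform_affact_exceptional // cfK.
rewrite -(affact_pr_exceptional _ F1y) // -[X in _ == X](symaut0 (reflection_seq F1)).
apply/eqP; rewrite -affact_const0; apply: eq_in_affact => f fF; apply: prP.
have F1f := zspan_root fF.
by rewrite mulr0 bformBr !key ?subrr // -?e12.
Qed.

End Forms.

(** * Words and their rewriting *)

Section Words.
Context {G : bilinLatticeType}.
Implicit Types (a f : lattice_root G) (x y z : G) (u v w : seq (lattice_root G)).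
Implicit Types (k : lattice_root G -> int).

(* The first letter of the word acts first, so that prepending a letter to [w]
   multiplies the corresponding group element on the right. *)
Definition run k w x : G :=
  foldl (fun y a => reflection a y + root_val a *~ k a) x w.

Lemma run_cons k a w x : run k (a :: w) x = run k w (run k [:: a] x).
Proof. by []. Qed.

Lemma run1 k a x : run k [:: a] x = reflection a x + root_val a *~ k a.
Proof. by []. Qed.

Lemma run_cat k u v x : run k (u ++ v) x = run k v (run k u x).
Proof. exact: foldl_cat. Qed.

Lemma run_rev k w x : run k (rev w) x = affact k w x.
Proof. exact: foldl_rev. Qed.

Lemma run_affact k w x : run k w x = affact k (rev w) x.
Proof. by rewrite -run_rev revK. Qed.

Lemma run1K k a : involutive (run k [:: a]).
Proof. by move=> x; have := affact_revK k [:: a] x. Qed.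

Lemma runD k w x y : run k w (x + y) = run k w x + run (fun=> 0) w y.
Proof. by rewrite !run_affact affactD affact_const0. Qed.

Lemma runMz0 w x m : run (fun=> 0) w (x *~ m) = run (fun=> 0) w x *~ m.
Proof. by rewrite !run_affact !affact_const0 symautMz. Qed.

(** Agreement for every [k], not only for the linear action: rewriting along [weq] preserves the
    cocycle as well as the product. *)
Definition weq u v := forall k x, run k u x = run k v x.

Lemma weq_trans u v w : weq u v -> weq v w -> weq u w.
Proof. by move=> uv vw k x; rewrite uv. Qed.

Lemma weq_sym u v : weq u v -> weq v u.
Proof. by move=> uv k x; rewrite uv. Qed.

Lemma weq_cat u u' v v' : weq u u' -> weq v v' -> weq (u ++ v) (u' ++ v').
Proof. by move=> uu vv k x; rewrite !run_cat uu vv. Qed.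

Lemma weq_cancel a w : weq [:: a, a & w] w.
Proof. by move=> k x; rewrite run_cons run_cons run1K. Qed.

Fixpoint alt n a f := if n is n'.+1 then a :: alt n' f a else [::].

Lemma altS n a f : alt n.+1 a f = a :: alt n f a.
Proof. by []. Qed.

Lemma size_alt n a f : size (alt n a f) = n.
Proof. by elim: n a f => //= n IH a f; rewrite IH. Qed.

Lemma alt_sub n a f : {subset alt n a f <= [:: a; f]}.
Proof.
elim: n a f => //= n IH a f g; rewrite in_cons => /predU1P[->|/IH].
  exact: mem_head.
by rewrite !inE orbC.
Qed.

Lemma altD m n a f : exists w,
  [/\ size w = n, {subset w <= [:: a; f]} & alt (m + n) a f = alt m a f ++ w].
Proof.
elim: m a f => [|m IH] a f.
  by exists (alt n a f); rewrite size_alt; split=> //; apply: alt_sub.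
have [w [sw wsub e]] := IH f a; exists w; rewrite addSn /= e; split=> // g.
by move=> /wsub; rewrite !inE orbC.
Qed.

(** * Rank two: dihedral words *)

Section RankTwo.
Variables i j : lattice_root G.
Hypotheses (ij0 : bform i j <= 0 :> int) (ji0 : bform j i <= 0 :> int).
Let a : int := - cf i j.
Let b : int := - cf j i.

Definition comb x (p q : int) : G := x + root_val i *~ p + root_val j *~ q.

Lemma comb00 x : comb x 0 0 = x.
Proof. by rewrite /comb !mulr0z !addr0. Qed.

Lemma comb10 : comb 0 1 0 = i.
Proof. by rewrite /comb mulr0z addr0 add0r mulr1z. Qed.

Lemma run_combl k w x p q :
  run k (i :: w) (comb x p q) = run k w (comb x (k i - cf i x - p + a * q) q).
Proof.
rewrite run_cons; congr run; rewrite run1 reflectionE /comb.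
rewrite !cfD !cfMz cf_root -addrA [_ + _ *~ k i]addrC -mulrzBr addrAC.
by rewrite -(addrA x) -mulrzDr; congr (_ + _ *~ _ + _); rewrite /a; ring.
Qed.

Lemma run_combr k w x p q :
  run k (j :: w) (comb x p q) = run k w (comb x p (k j - cf j x - q + b * p)).
Proof.
rewrite run_cons; congr run; rewrite run1 reflectionE /comb.
rewrite !cfD !cfMz cf_root -addrA [_ + _ *~ k j]addrC -mulrzBr -addrA.
by rewrite -mulrzDr; congr (_ + _ *~ _); rewrite /b; ring.
Qed.

Lemma cartan_ge0 : [/\ 0 <= a, 0 <= b & (a == 0) = (b == 0)].
Proof.
have i0 := bform_root_gt0 i; have j0 := bform_root_gt0 j.
have := cfK i j; have := cfK j i; rewrite /symform.
have -> : cf i j = - a by rewrite opprK.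
have -> : cf j i = - b by rewrite opprK.
by split; [nia | nia |]; apply/eqP/eqP; nia.
Qed.

Definition nonneg_comb x := exists p q : int, [/\ 0 <= p, 0 <= q & x = comb 0 p q].

(** For x = p i + q j the two conditions read [0 <= cf i x] and [0 <= cf j x]. Given the first, 4 <=
    a b yields 2 q <= b p, so [j] does not decrease q and establishes the second; then the roles
    alternate. *)
Lemma infinite_dihedral n p q : 4 <= a * b -> 0 <= p -> 0 <= q ->
  (a * q <= 2 * p -> nonneg_comb (run (fun=> 0) (alt n j i) (comb 0 p q))) /\
  (b * p <= 2 * q -> nonneg_comb (run (fun=> 0) (alt n i j) (comb 0 p q))).
Proof.
have [a0 b0 _] := cartan_ge0.
move=> ab; elim: n p q => [|n IH] p q p0 q0; first by split=> _; exists p, q.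
split=> h.
  have q'0 : 0 <= 0 - 0 - q + b * p by nia.
  by rewrite altS run_combr cf0; apply: (IH _ _ p0 q'0).2; nia.
have p'0 : 0 <= 0 - 0 - p + a * q by nia.
by rewrite altS run_combl cf0; apply: (IH _ _ p'0 q0).1; nia.
Qed.

Lemma finite_dihedral : a * b < 4 -> exists m,
  [/\ (0 < m)%N, weq (alt m i j) (alt m j i)
    & forall n, (n < m)%N -> nonneg_comb (run (fun=> 0) (alt n j i) i)].
Proof.
have [a0 b0 ab0] := cartan_ge0 => ab.
(* The types A1 x A1, A2, B2 and G2, with [m] the order of the product of the two reflections. *)
have cases (c d : int) : 0 <= c -> 0 <= d -> (c == 0) = (d == 0) -> c * d < 4 ->
    exists2 m, (0 < m)%N & [|| [&& c == 0, d == 0 & m == 2%N],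
      [&& c == 1, d == 1 & m == 3%N],
      [&& c == 1, d == 2 & m == 4%N], [&& c == 2, d == 1 & m == 4%N],
      [&& c == 1, d == 3 & m == 6%N] | [&& c == 3, d == 1 & m == 6%N]].
  case: c => [[|[|[|[|c]]]]|c] // _; case: d => [[|[|[|[|d]]]]|d] // _ _ cd;
    try by [exists 2%N | exists 3%N | exists 4%N | exists 6%N | lia].
have [m m0 H] := cases a b a0 b0 ab0 ab; exists m.
(* With zero coordinates over a free x, the braid relation becomes a comparison of two integer
   coefficients. *)
have [E P] :
    (forall k x, run k (alt m i j) (comb x 0 0) = run k (alt m j i) (comb x 0 0))
    /\ forall n, (n < m)%N -> nonneg_comb (run (fun=> 0) (alt n j i) (comb 0 1 0)).
  have nonneg p q (x : G) : x = comb 0 p q -> (0 <= p) && (0 <= q) -> nonneg_comb x.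
    by move=> -> /andP[? ?]; exists p, q.
  by move: H => /or4P[||| /or3P[||]] /and3P[/eqP ea /eqP eb /eqP ->]; (split;
   [ by move=> k x; rewrite !altS !(run_combl, run_combr) ea eb; congr (comb _ _ _); ring
   | case=> [|[|[|[|[|[|n]]]]]] // _;
     rewrite ?altS ?(run_combl, run_combr) ?cf0 ?ea ?eb; exact: nonneg ]).
split=> // [k x|n]; first by have := E k x; rewrite comb00.
by rewrite -[root_val i in X in _ -> X]comb10; apply: P.
Qed.


Lemma dihedral_normal_form w : {subset w <= [:: i; j]} -> exists n,
  (n <= size w)%N /\ (weq w (alt n i j) \/ weq w (alt n j i)).
Proof.
elim: w => [|c w IH] wsub; first by exists 0%N; split=> //; left.
have [|n [nw h]] := IH; first by move=> f fw; apply: wsub; rewrite in_cons fw orbT.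
have cons_weq u : weq w u -> weq (c :: w) (c :: u).
  by move=> wu; apply: (@weq_cat [:: c] [:: c]).
have extend f g : c = f -> weq w (alt n g f) -> exists n', (n' <= (size w).+1)%N /\
    (weq (c :: w) (alt n' f g) \/ weq (c :: w) (alt n' g f)).
  by move=> <- h'; exists n.+1; split=> //; left; apply: cons_weq.
have cancel f g : c = f -> weq w (alt n f g) -> exists n', (n' <= (size w).+1)%N /\
    (weq (c :: w) (alt n' f g) \/ weq (c :: w) (alt n' g f)).
  case: n nw {h extend} => [|n] nw cf h'.
    by exists 1%N; split=> //; left; rewrite -cf; apply: cons_weq.
  exists n; split; first by lia.
  by right; apply: weq_trans (cons_weq _ h') _; rewrite cf; apply: weq_cancel.
have := wsub c (mem_head _ _); rewrite !inE => /orP[]/eqP ec.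
  by case: h => h; [apply: cancel | apply: extend].
have [n' [? ?]] : exists n', (n' <= (size w).+1)%N /\
    (weq (c :: w) (alt n' j i) \/ weq (c :: w) (alt n' i j)).
  by case: h => h; [apply: extend | apply: cancel].
by exists n'; split=> //; apply/or_comm.
Qed.

(** Pass to an alternating word. If it starts with [i], the prepended [i] cancels. If it starts with
    [j], either the image of [i] is nonnegative, or the word is long enough for the braid relation
    to make it start with [i]. *)
Lemma dihedral_root w : {subset w <= [:: i; j]} ->
  nonneg_comb (run (fun=> 0) w i) \/
  exists u, [/\ {subset u <= [:: i; j]}, (size u < size w)%N & weq u (i :: w)].
Proof.
move=> wsub; have [n [nw [wn|wn]]] := dihedral_normal_form wsub.
  case: n nw wn => [|n] nw wn.
    left; exists 1, 0; split=> //; rewrite comb10.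
    exact: wn.
  right; exists (alt n j i); split.
  - by move=> f /alt_sub; rewrite !inE orbC.
  - by rewrite size_alt.
  apply: weq_sym; apply: weq_trans (weq_cancel i _).
  by apply: (@weq_cat [:: i] [:: i]).
have wE : run (fun=> 0) w i = run (fun=> 0) (alt n j i) (comb 0 1 0).
  by rewrite comb10.
have [ab|ab] := lerP 4 (a * b).
  left; rewrite wE; apply: (infinite_dihedral n _ _ _).1 => //.
  by rewrite mulr0.
have [m [m0 braid pos]] := finite_dihedral ab.
have [nm|mn] := ltnP n m; first by left; rewrite wE comb10; apply: pos.
right; have [v [sv vsub e]] := altD m (n - m) j i.
case: m m0 {pos} braid mn sv e => // m _ braid mn sv e; rewrite subnKC // in e.
exists (alt m j i ++ v); split.
- move=> f; rewrite mem_cat => /orP[/alt_sub|/vsub]; by rewrite !inE orbC.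
- by rewrite size_cat size_alt sv; lia.
apply: weq_sym; apply: (@weq_trans _ (i :: alt m.+1 i j ++ v)).
  apply: (@weq_cat [:: i] [:: i]) => //; apply: weq_trans wn _; rewrite e.
  by apply: weq_cat => //; apply: weq_sym.
by rewrite altS; apply: weq_cancel.
Qed.

End RankTwo.

(** * Coxeter-theoretic positivity *)

Section SimpleSystem.
Variable E : seq (lattice_root G).
Hypothesis hE : orthogonal_seq E.

Lemma simple_bform_le0 f g : f \in E -> g \in E -> f != g ->
  bform f g <= 0 :> int.
Proof.
move: hE; rewrite /orthogonal_seq; elim: E => [//|a s IH].
rewrite pairwise_cons => /andP[/allP sa hs]; rewrite !in_cons.
case/predU1P=> [->|fs] /predU1P[->|gs]; first by rewrite eqxx.
- by case/andP: (sa g gs).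
- by case/andP: (sa f fs).
- exact: IH.
Qed.

Inductive nonneg : G -> Prop :=
| nonneg0 : nonneg 0
| nonneg_add f x : f \in E -> nonneg x -> nonneg (root_val f + x).

Lemma nonnegD x y : nonneg x -> nonneg y -> nonneg (x + y).
Proof.
move=> hx hy; elim: hx => [|f z fE _ IH]; first by rewrite add0r.
by rewrite -addrA; apply: nonneg_add.
Qed.

Lemma nonnegMz x m : nonneg x -> 0 <= m :> int -> nonneg (x *~ m).
Proof.
case: m => // m hx _; elim: m => [|m IH]; first exact: nonneg0.
by rewrite -[x *~ _]/(x *+ m.+1) mulrS; apply: nonnegD.
Qed.

Lemma nonneg_root f : f \in E -> nonneg f.
Proof.
move=> fE; rewrite -[root_val f]addr0.
by apply: nonneg_add => //; apply: nonneg0.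
Qed.

Lemma nonneg_bform0 x z : (forall f, f \in E -> 0 < bform f z :> int) ->
  nonneg x -> 0 <= bform x z /\ (bform x z = 0 -> x = 0).
Proof.
move=> z0; elim=> [|f y fE _ [IH _]]; first by rewrite bform0l.
have := z0 f fE; rewrite bformDl => f0; split; first by lia.
by move=> ?; lia.
Qed.

(* A shortest [v] with [w] equivalent to [u ++ v], [u] a word in [i] and [j],
   sends [i] and [j] to nonnegative vectors; this leaves a question about [u]. *)
Lemma exchange w i : {subset w <= E} -> i \in E ->
  nonneg (run (fun=> 0) w i) \/
  exists u, [/\ {subset u <= E}, (size u < size w)%N & weq u (i :: w)].
Proof.
have [N] := ubnP (size w); elim: N w i => // N IH w i wN wE iE.
case: w wN wE => [|j w] wN wE; first by left; apply: nonneg_root.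
have jE : j \in E by apply: wE; apply: mem_head.
have wE' : {subset w <= E} by move=> f fw; apply: wE; rewrite in_cons fw orbT.
have [->|ij] := eqVneq j i.
  by right; exists w; split=> //; apply: weq_sym; apply: weq_cancel.
pose P m := `[< exists u v, [/\ {subset u <= [:: i; j]}, {subset v <= E},
  size v = m, (size u + m <= (size w).+1)%N & weq (j :: w) (u ++ v)] >].
have exP : exists m, P m.
  exists (size w); apply/asboolP; exists [:: j], w; split=> // f.
  by rewrite !inE => ->; rewrite orbT.
have [m /asboolP[u [v [uij vE sv uv wuv]]] mmin] := ex_minnP exP.
(* This makes [v] shorter than [j :: w], so the induction hypothesis applies to it. *)
have mw : (m <= size w)%N.
  apply: mmin; apply/asboolP; exists [:: j], w; split=> // f.
  by rewrite !inE => ->; rewrite orbT.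
have vpos f : f \in [:: i; j] -> nonneg (run (fun=> 0) v f).
  move=> fij; have fE : f \in E by move: fij; rewrite !inE => /orP[]/eqP->.
  have [|//|[v' [v'E sv' v'w]]] := IH v f _ vE fE.
    by rewrite sv; move: wN => /=; lia.
  (* Otherwise the letter [f] could be moved from [v] to the end of [u], leaving the shorter [v']
     against minimality. *)
  suff : (m <= size v')%N by lia.
  apply: mmin; apply/asboolP; exists (rcons u f), v'; split=> //.
  - by move=> g; rewrite mem_rcons in_cons => /predU1P[->|/uij].
  - by rewrite size_rcons; lia.
  apply: weq_trans wuv _; rewrite -cats1 -catA; apply: weq_cat => //.
  apply: weq_sym; apply: weq_trans (weq_cancel f _).
  by apply: (@weq_cat [:: f] [:: f]).
have ij0 : bform i j <= 0 by apply: simple_bform_le0; rewrite // eq_sym.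
have ji0 := simple_bform_le0 jE iE ij.
have wrun : run (fun=> 0) (j :: w) i = run (fun=> 0) v (run (fun=> 0) u i).
  by rewrite wuv run_cat.
have [[p [q [p0 q0 e]]]|[u' [u'ij su' u'u]]] := dihedral_root ij0 ji0 uij.
  left; rewrite wrun e /comb add0r runD !runMz0.
  by apply: nonnegD; apply: nonnegMz => //; apply: vpos; rewrite !inE eqxx ?orbT.
right; exists (u' ++ v); split.
- move=> f; rewrite mem_cat => /orP[/u'ij|/vE //]; by rewrite !inE => /orP[]/eqP->.
- by rewrite size_cat sv /=; lia.
apply: (@weq_trans _ ((i :: u) ++ v)); first exact: weq_cat.
by apply: (@weq_cat [:: i] [:: i]) => //; apply: weq_sym.
Qed.

(** The first letter [i] adds w(i) times [pr z i >= 0] to the value for [w]. If w(i) is not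
    nonnegative, [exchange] supplies a shorter equivalent word. *)
Lemma run_dominant w z :
    {subset w <= E} -> (forall f, f \in E -> 0 <= bform f z :> int) ->
  nonneg (run (pr z) w 0).
Proof.
move=> + z0; have [N] := ubnP (size w); elim: N w => // N IH [|i w] wN wE.
  by move=> *; apply: nonneg0.
have iE : i \in E by apply: wE; apply: mem_head.
have wE' : {subset w <= E} by move=> f fw; apply: wE; rewrite in_cons fw orbT.
have [ipos|[u [uE su uw]]] := exchange wE' iE; last first.
  by rewrite -uw; apply: IH => //; move: wN su => /=; lia.
rewrite run_cons run1 symaut0 runD runMz0; apply: nonnegD; first exact: IH.
apply: nonnegMz => //; have := z0 i iE; rewrite -prK.
by have := bform_root_gt0 i; nia.
Qed.

End SimpleSystem.
End Words.

(** * Invariant pairings and vanishing of the cocycle *)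

Section Kernel.
Context {G : bilinLatticeType}.
Implicit Types (a f : lattice_root G) (x y z : G) (w L : seq (lattice_root G)).

(** This is the invariant norm of <-, z> - y in the extended lattice, up to the constant norm of <-,
    z>. *)
Lemma run_norm w z y :
  symform (run (pr z) w y) (run (pr z) w y) - 2 * bform (run (pr z) w y) z =
  symform y y - 2 * bform y z.
Proof.
elim: w y => [//|a w IH] y; rewrite run_cons {}IH run1.
set m := pr z a; set s := reflection a y.
have ss : symform s s = symform y y := symaut_sym _ _ _.
have sa : symform s a = - symform y a := symform_reflection_root _ _.
have sz : bform s z = bform y z - bform a z * cf a y.
  by rewrite /s reflectionE bformBl bformMzl.
have az := prK a z; have ya := cfK a y.
have aa : symform a a = 2 * bform a a by rewrite /symform; lia.
clearbody s; rewrite !symformDl !symformDr !symformMzl !symformMzr bformDl bformMzl.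
rewrite (symformC a s) ss sa sz aa -az -ya -/m; ring.
Qed.

(** This is the invariant pairing of <-, z> - y with x; y moves affinely and x linearly. *)
Lemma run_pairing w z y x :
  bform (run (fun=> 0) w x) z - symform (run (pr z) w y) (run (fun=> 0) w x) =
  bform x z - symform y x.
Proof.
elim: w x y => [//|a w IH] x y; rewrite !(run_cons _ a w) {}IH !run1 mulr0z addr0.
set m := pr z a; have ss : symform (reflection a y) (reflection a x) = symform y x.
  exact: symaut_sym.
have sa : symform (reflection a x) a = - symform x a.
  exact: symform_reflection_root.
have sz : bform (reflection a x) z = bform x z - bform a z * cf a x.
  by rewrite reflectionE bformBl bformMzl.
move: (reflection a y) (reflection a x) ss sa sz => s t ss sa sz.
rewrite symformDl symformMzl (symformC a) ss sa sz -(prK a z) -(cfK a x) -/m.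
by ring.
Qed.

Variable E : seq (lattice_root G).
Hypotheses (exE : exceptional_seq E) (orE : orthogonal_seq E).

Lemma dominant_kernel w z : {subset w <= E} -> reflection_seq w = 1%g ->
  (forall f, f \in E -> 0 < bform f z :> int) -> affact (pr z) w 0 = 0.
Proof.
move=> wE w1 z0; rewrite -run_rev; set D := run _ _ _.
have D0 : nonneg E D.
  apply: run_dominant => // f; last by move=> fE; apply/ltW/z0.
  by rewrite mem_rev; apply: wE.
have rad x : symform D x = 0.
  have := run_pairing (rev w) z 0 x; rewrite run_rev affact_const0 w1 -/D /=.
  by rewrite {2}/symform bform0l bform0r; lia.
(* As D is in the radical, invariance of the norm reduces to <D, z> = 0. *)
have := run_norm (rev w) z 0; rewrite -/D rad {1}/symform !bform0l => Dz.
by apply: (nonneg_bform0 z0 D0).2; lia.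
Qed.

Lemma simple_kernel w z : {subset w <= E} -> reflection_seq w = 1%g ->
  affact (pr z) w 0 = 0.
Proof.
(* Since <f, z0> = <f, f> > 0 on [E], any z is the difference of z + M z0 and M z0, both strictly
   dominant for suitable M; the cocycle is additive in z. *)
move=> wE w1; pose z0 := affact (fun=> 1) E 0.
have z0E f : f \in E -> bform f z0 = bform f f.
  by move=> fE; rewrite bform_affact_exceptional // mulr1.
have [M M0 HM] : exists2 M : int, 0 < M &
    forall f, f \in E -> 0 < bform f z + bform f f * M.
  elim: E => [|a s [M M0 HM]]; first by exists 1.
  exists (M + `|bform a z|); first by lia.
  move=> f; rewrite in_cons => /predU1P[->|/HM].
    by have := bform_root_gt0 a; nia.
  by have := bform_root_gt0 f; nia.
have k1 : affact (pr (z + z0 *~ M)) w 0 = 0.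
  by apply: dominant_kernel => // f fE; rewrite bformDr bformMzr z0E // HM.
have k2 : affact (pr (z0 *~ M)) w 0 = 0.
  apply: dominant_kernel => // f fE; rewrite bformMzr z0E //.
  by have := bform_root_gt0 f; nia.
have := affactBk (pr (z + z0 *~ M)) (pr (z0 *~ M)) w; rewrite k1 k2 subrr => e.
rewrite -[RHS]e; apply: eq_in_affact => f _.
by rewrite prD addrK.
Qed.

End Kernel.

(** * Weyl group, real roots and real reflections *)

Section CartanLattice.
Context {G : bilinLatticeType} (n : nat) (E : n.-tuple (lattice_root G)).
Implicit Types (a f : lattice_root G) (x y z : G) (F L w : seq (lattice_root G)).

Lemma Weyl_groupP (g : symaut G) :
  Weyl_group E g <-> exists2 w, {subset w <= E} & reflection_seq w = g.
Proof.
split=> [H|[w wE <-]]; last first.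
  move=> H [[H1 HM _] HE]; elim: w wE => [|a w IH] wE.
    by rewrite /reflection_seq big_nil.
  rewrite reflection_seq_cons; apply: HM.
    by apply: HE; exists a => //=; apply: wE; apply: mem_head.
  by apply: IH => f fw; apply: wE; rewrite in_cons fw orbT.
apply: (H [set g | exists2 w, {subset w <= E} & reflection_seq w = g]).
split; first split=> [|_ _ [u uE <-] [v vE <-]|_ [u uE <-]].
- by exists [::] => //; rewrite /reflection_seq big_nil.
- exists (u ++ v); last exact: reflection_seq_cat.
  by move=> f; rewrite mem_cat => /orP[/uE|/vE].
- exists (rev u); last exact: reflection_seq_rev.
  by move=> f; rewrite mem_rev => /uE.
move=> _ [a /= aE <-]; exists [:: a]; last by rewrite /reflection_seq big_seq1.
by move=> f; rewrite inE => /eqP->.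
Qed.

Definition real_seq L := forall f, f \in L -> real_roots E f.

Lemma simple_real f : f \in E -> real_roots E f.
Proof.
case/tnthP => i ->; exists 1%g, i; split=> //.
by apply/Weyl_groupP; exists [::] => //; rewrite /reflection_seq big_nil.
Qed.

Lemma real_cat L1 L2 : real_seq L1 -> real_seq L2 -> real_seq (L1 ++ L2).
Proof. by move=> h1 h2 f; rewrite mem_cat => /orP[/h1|/h2]. Qed.

(** For a = w(e) the conjugate word w e w^-1 gives the same affine map, not just the same
    reflection: [run_pairing] and <a, a> = <e, e> match the coefficients of the translations along
    [a]. *)
Lemma real_root_word a : real_roots E a -> exists2 w, {subset w <= E} &
  forall z x, affact (pr z) [:: a] x = affact (pr z) w x.
Proof.
case=> g [i [/Weyl_groupP[w wE <-] ea]]; set e := tnth E i in ea.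
exists (w ++ e :: rev w).
  move=> f; rewrite mem_cat in_cons mem_rev => /or3P[/wE //|/eqP->|/wE //].
  exact: mem_tnth.
move=> z x; rewrite affact_cat affact_consE (affact_consE _ e) affactD symautMz.
have -> : affact (pr z) w (affact (pr z) (rev w) x) = x.
  by rewrite -{1}(revK w) affact_revK.
rewrite affact_nil ea; congr (_ + _ *~ _); set y := affact _ (rev w) x.
have := run_pairing (rev w) z y e; rewrite !run_rev affact_const0.
have -> : affact (pr z) w y = x by rewrite -{1}(revK w) affact_revK.
rewrite -ea -(prK a z) -(prK e z) -!cfK (_ : bform a a = bform e e); last first.
  by rewrite ea bform_symaut.
by rewrite -!mulrBr => /(mulfI (bform_root_neq0 e)).
Qed.

Lemma real_seq_word L : real_seq L -> exists2 w, {subset w <= E} &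
  forall z x, affact (pr z) L x = affact (pr z) w x.
Proof.
elim: L => [|a L IH] hL; first by exists [::].
have [|w wE hw] := IH; first by move=> f fL; apply: hL; rewrite in_cons fL orbT.
have [u uE hu] := real_root_word (hL a (mem_head _ _)).
exists (u ++ w) => [f|z x]; first by rewrite mem_cat => /orP[/uE|/wE].
by rewrite affact_cat -hw -hu.
Qed.

Lemma affact_pr0 L x : affact (pr 0) L x = reflection_seq L x.
Proof.
rewrite -affact_const0; apply: eq_in_affact => f _; apply: prP.
by rewrite mulr0 bform0r.
Qed.

Lemma real_reflection_conj g a : Weyl_group E g -> real_roots E a ->
  exists2 b : lattice_root G, real_roots E b &
    reflection b = (g * reflection a * g^-1)%g.
Proof.
move=> Wg [h [i [Wh ea]]].
have real_ga : real_roots E (g a).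
  exists (g * h)%g, i; split; last by rewrite ea.
  move: Wg Wh => /Weyl_groupP[u uE <-] /Weyl_groupP[v vE <-].
  apply/Weyl_groupP; exists (u ++ v); last exact: reflection_seq_cat.
  by move=> f; rewrite mem_cat => /orP[/uE|/vE].
have /asboolP ga := real_roots_is_root real_ga; exists (LatticeRoot ga) => //.
apply: symaut_eq => x; rewrite !symaut_mulE !reflectionE symautB symautMz.
rewrite -[g (_ x)]/((g * g^-1)%g x) mulgV /=; congr (_ - _ *~ _); apply: cfP.
by rewrite bform_symaut cfK -{1}(symautKV g x) symaut_sym.
Qed.

Lemma real_seq_Weyl L : real_seq L -> Weyl_group E (reflection_seq L).
Proof.
move=> /real_seq_word[w wE hw]; apply/Weyl_groupP; exists w => //.
by apply: symaut_eq => x; rewrite -!affact_pr0 hw.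
Qed.

(** Hurwitz moves: an omitted reflection passes to the right of the chosen ones, replaced by a
    conjugate, which is again a real reflection. *)
Lemma subseq_complement F L : real_seq L -> subseq F L ->
  exists L', [/\ real_seq L', (size F + size L' = size L)%N &
    reflection_seq L = (reflection_seq F * reflection_seq L')%g].
Proof.
elim: L F => [|c L IH] [|f F] hL //.
- by exists [::]; split=> //; rewrite /reflection_seq big_nil mulg1.
- by exists (c :: L); split=> //; rewrite {2}/reflection_seq big_nil mul1g.
have hL' : real_seq L by move=> g gL; apply: hL; rewrite in_cons gL orbT.
have hc := hL c (mem_head _ _).
move=> FL; have hF : real_seq (f :: F) by move=> g /(mem_subseq FL)/hL.
move: FL; rewrite /=; case: eqP => [->|_] /(IH _ hL')[L' [hL'' sL' e]].
  exists L'; split=> //; first by rewrite addSn sL'.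
  by rewrite !reflection_seq_cons e mulgA.
have Wg : Weyl_group E (reflection_seq (f :: F))^-1%g.
  by rewrite -reflection_seq_rev; apply: real_seq_Weyl => g; rewrite mem_rev => /hF.
have [b rb eb] := real_reflection_conj Wg hc.
exists (b :: L'); split.
- by move=> g; rewrite in_cons => /predU1P[->|/hL''].
- by rewrite /= addnS -sL'.
- rewrite !(reflection_seq_cons _ L, reflection_seq_cons _ L') e eb.
  by rewrite invgK !mulgA mulgV mul1g.
Qed.

(** * Factorisations of the Coxeter element *)

Hypothesis hE : generalised_Cartan E.

(** Expand both sides as words u and v in [E]. The word v^-1 u has trivial product, so it fixes 0 by
    [simple_kernel]; then apply v. *)
Lemma real_seq_affact_eq L1 L2 z : real_seq L1 -> real_seq L2 ->
  reflection_seq L1 = reflection_seq L2 ->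
  affact (pr z) L1 0 = affact (pr z) L2 0.
Proof.
have [exE _ orE] := hE.
move=> /real_seq_word[u uE hu] /real_seq_word[v vE hv] e.
have uv : reflection_seq u = reflection_seq v.
  by apply: symaut_eq => x; rewrite -!affact_pr0 -hu -hv !affact_pr0 e.
rewrite hu hv -[LHS](affact_revK (pr z) (rev v)) revK; congr affact.
rewrite -affact_cat; apply: simple_kernel exE orE _ _ _ _.
  by move=> f; rewrite mem_cat mem_rev => /orP[/vE|/uE].
by rewrite reflection_seq_cat reflection_seq_rev uv mulVg.
Qed.

Lemma zspan_coef L x : zspan L x ->
  exists c : 'I_(size L) -> int, x = \sum_j root_val (tnth (in_tuple L) j) *~ c j.
Proof.
move: x; apply: zspan_sub => [|f fL].
  split=> [|x y [c ->] [d ->]]; first by exists (fun=> 0); rewrite big1.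
  exists (fun j => c j - d j); rewrite -sumrB.
  by apply: eq_bigr => j _; rewrite mulrzBr.
have /tnthP[i ->] : f \in in_tuple L by [].
exists (fun j => (j == i)%:Z); rewrite (bigD1 i) //= eqxx mulr1z big1 ?addr0 //.
by move=> j /negbTE ->; rewrite mulr0z.
Qed.

(* The Gram matrix of [E] is triangular with nonzero diagonal. *)
Lemma rank_bound L (N : int) :
  N != 0 -> (forall x, zspan L (x *~ N)) -> (n <= size L)%N.
Proof.
move=> N0 hL; have [exE _ _] := hE.
have [c hc] := choice (fun i => zspan_coef (hL (tnth E i))).
(* [A], which is N times the Gram matrix of [E], has rank n and factors through a matrix with
   [size L] rows. *)
pose C := \matrix_(i < n, j < size L) (c i j)%:~R : 'M[rat]_(_, _).
pose M : 'M[rat]_(_, _) := \matrix_(j < size L, i < n)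
  (bform (tnth (in_tuple L) j) (tnth E i))%:~R.
pose A := \matrix_(i < n, j < n) (bform (tnth E i) (tnth E j) * N)%:~R : 'M[rat]_n.
have AE : A = C *m M.
  apply/matrixP => i j; rewrite !mxE -bformMzl hc.
  rewrite (big_morph (bform^~ (tnth E j)) (fun x y => bformDl x y _) (bform0l _)).
  by rewrite rmorph_sum; apply: eq_bigr => l _; rewrite !mxE bformMzl mulrC rmorphM.
have unitA : A \in unitmx.
  rewrite -unitmx_tr unitmxE det_trig.
    rewrite unitfE; apply/prodf_neq0 => i _; rewrite !mxE intr_eq0 mulf_neq0 //.
    exact: bform_root_neq0.
  apply/is_trig_mxP => i j ij; rewrite !mxE.
  move: exE => /(pairwiseP (tnth E i)) /(_ i j).
  rewrite !inE !size_tuple !ltn_ord -!tnth_nth => /(_ isT isT ij)/eqP ->.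
  by rewrite mul0r.
by rewrite -(mxrank_unit unitA) AE (leq_trans (mxrankM_maxr _ _)) ?rank_leq_row.
Qed.

Lemma affact_coxeter L z : real_seq L -> reflection_seq L = reflection_seq E ->
  affact (pr z) L 0 = z.
Proof.
have [exE cE _] := hE => hL e; rewrite (@real_seq_affact_eq L E) //.
  by apply: affact_pr_exceptional => //; rewrite cE.
exact: simple_real.
Qed.

Lemma coxeter_factorisation_complete L : real_seq L ->
  reflection_seq L = reflection_seq E -> complete_seq L.
Proof.
move=> hL e; apply/seteqP; split=> // z _.
by rewrite -(affact_coxeter z hL e); apply: affact_zspan.
Qed.

Lemma coxeter_factorisation_size L : real_seq L ->
  reflection_seq L = reflection_seq E -> (n <= size L)%N.
Proof.
move=> hL e; apply: (@rank_bound L 1) => // x.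
by rewrite (coxeter_factorisation_complete hL e).
Qed.

(** Induction along suffixes of [L], with the invariant that the cocycle of a suffix fixes its span
    pointwise. *)
Lemma coxeter_factorisation_exceptional L : real_seq L ->
  reflection_seq L = reflection_seq E -> size L = n -> exceptional_seq L.
Proof.
move=> hL e sL; have cL := coxeter_factorisation_complete hL e.
have fixL z : zspan L z -> affact (pr z) L 0 = z by move=> _; apply: affact_coxeter.
suff : forall L1 L2, L = L1 ++ L2 ->
    (forall z, zspan L2 z -> affact (pr z) L2 0 = z) -> exceptional_seq L2.
  by move/(_ [::] L erefl fixL).
move=> L1 L2; elim: L2 L1 => [//|a L2 IH] L1 eL fixa.
(* The difference m of the two coefficients puts m a into the span of [L2]. If m were nonzero, the n
   - 1 roots other than this [a] would span a subgroup containing m times the lattice, against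
   [rank_bound]. *)
have keep z : zspan L2 z -> pr z a = cf a (affact (pr z) L2 0).
  move=> L2z; apply/eqP; rewrite -subr_eq0; apply: contraT => m0.
  suff : (n <= size (L1 ++ L2))%N by rewrite -sL eL !size_cat /=; lia.
  apply: (rank_bound m0) => x; set m := _ - _.
  have sub : zspan L2 `<=` zspan (L1 ++ L2).
    by apply: zspan_mono => f fL; rewrite mem_cat fL orbT.
  have am : zspan (L1 ++ L2) (root_val a *~ m).
    have az : zspan (a :: L2) z.
      by apply: zspan_mono L2z => f; rewrite in_cons orbC => ->.
    have -> : root_val a *~ m = z - affact (pr z) L2 0.
      by rewrite -{1}(fixa z az) affact_consE addrAC subrr add0r.
    have [_ B] := zspan_zsubgroup (L1 ++ L2).
    by apply: B; apply: sub => //; apply: affact_zspan.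
  have : zspan L x by rewrite cL.
  move: x; apply: zspan_sub => [|f].
    have [h0 hB] := zspan_zsubgroup (L1 ++ L2).
    by split=> [|x y hx hy] /=; rewrite ?mul0rz // mulrzBl; apply: hB.
  rewrite eL mem_cat in_cons orbCA => /predU1P[-> //|fL].
  apply: (zsubgroupMz (zspan_zsubgroup _)); apply: zspan_root.
  by rewrite mem_cat.
have fix2 z : zspan L2 z -> affact (pr z) L2 0 = z.
  move=> L2z; have az : zspan (a :: L2) z.
    by apply: zspan_mono L2z => f; rewrite in_cons orbC => ->.
  by rewrite -{2}(fixa z az) affact_consE (keep z L2z) subrr mulr0z addr0.
apply/exceptional_cons; split; last by apply: (IH (rcons L1 a)); rewrite ?cat_rcons.
(* For z = f the equal coefficients read <a, f> = <f, a> + <a, f>. *)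
move=> f fL; have L2f := zspan_root fL; have := keep f L2f.
rewrite fix2 // => /(congr1 (fun m => bform a a * m)); rewrite prK cfK /symform.
lia.
Qed.

(** * Absolute length *)

Lemma product_of_reflectionsP g m : product_of_reflections E g m <->
  exists L, [/\ real_seq L, size L = m & reflection_seq L = g].
Proof.
split=> [[t tr ->]|[L [hL <- <-]]].
  have ex i : exists a : lattice_root G, real_roots E a /\ reflection a = tnth t i.
    by have [a ra ea] := tr i; exists a.
  have [L hL] := choice ex.
  exists [seq L i | i <- enum 'I_m]; split.
  - by move=> f /mapP[i _ ->]; case: (hL i).
  - by rewrite size_map size_enum_ord.
  rewrite /reflection_seq big_map -[in RHS](map_tnth_enum t) [RHS]big_map.
  by apply: eq_bigr => i _; case: (hL i).
exists [tuple of [seq reflection f | f <- in_tuple L]]; last by rewrite big_map.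
by move=> i; rewrite tnth_map; exists (tnth (in_tuple L) i) => //; apply/hL/mem_tnth.
Qed.

Lemma abs_length_le L : real_seq L -> (abs_length E (reflection_seq L) <= size L)%N.
Proof.
move=> hL; rewrite /abs_length; case: pselect => // ex.
case: ex_minnP => m _; apply; apply/asboolP/product_of_reflectionsP.
by exists L.
Qed.

Lemma abs_length_attained L : real_seq L -> exists L', [/\ real_seq L',
  size L' = abs_length E (reflection_seq L) & reflection_seq L' = reflection_seq L].
Proof.
move=> hL; rewrite /abs_length; case: pselect => [ex|[]].
  by case: ex_minnP => m /asboolP/product_of_reflectionsP[L' ?] _; exists L'.
by exists (size L); apply/asboolP/product_of_reflectionsP; exists L.
Qed.

Lemma abs_length_coxeter : abs_length E (reflection_seq E) = n.
Proof.
have rE : real_seq E := simple_real.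
have := abs_length_le rE; rewrite size_tuple => le_n; apply/eqP; rewrite eqn_leq le_n.
by have [L [hL <- /coxeter_factorisation_size->]] := abs_length_attained rE.
Qed.

Lemma complete_real_coxeter (C : seq (lattice_root G)) :
  exceptional_seq C -> complete_seq C -> reflection_seq C = reflection_seq E.
Proof.
have [exE cE _] := hE => hC cC; apply: exceptional_zspan_eq => //.
by rewrite cE cC.
Qed.

Lemma real_exceptional_real F : real_exceptional E F -> real_seq F.
Proof.
by move=> [C [_ _ rC FC]] f /(mem_subseq FC)/tnthP[i ->].
Qed.

Lemma real_exceptional_exceptional F : real_exceptional E F -> exceptional_seq F.
Proof. by move=> [C [xC _ _ FC]]; apply: subseq_pairwise xC. Qed.

End CartanLattice.

End NonCrossing.

(** * Fibres and image of the map on real exceptional sequences *)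

Theorem proposition3p6 (G : bilinLatticeType) (n : nat) (E : n.-tuple (lattice_root G))
  (hE : generalised_Cartan E) :
  [set reflection_seq F | F in [set F | real_exceptional E F]] = NC E /\
  (forall F F' : seq (lattice_root G),
     real_exceptional E F -> real_exceptional E F' ->
     (reflection_seq F = reflection_seq F' <-> zspan F = zspan F')).
Proof.
split; last first.
  move=> F F' hF hF'.
  have xF := real_exceptional_exceptional hF.
  have xF' := real_exceptional_exceptional hF'.
  split=> [e|]; last exact: exceptional_zspan_eq.
  (* Any z in the span of [F1] is its own cocycle value along [F1], hence along [F2], and so lies in
     the span of [F2]. *)
  have sub F1 F2 : real_exceptional E F1 -> real_exceptional E F2 ->
      reflection_seq F1 = reflection_seq F2 -> zspan F1 `<=` zspan F2.
    move=> h1 h2 e12 z F1z.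
    rewrite -(affact_pr_exceptional (real_exceptional_exceptional h1) F1z).
    rewrite (@real_seq_affact_eq _ _ _ hE F1 F2) //; first exact: affact_zspan.
      exact: real_exceptional_real h1.
    exact: real_exceptional_real h2.
  by apply/seteqP; split; apply: sub.
have length1 : abs_length E 1%g = 0%N.
  have := @abs_length_le _ _ E [::]; rewrite /reflection_seq big_nil leqn0.
  by move=> /(_ _)/eqP; apply=> f.
have length_c := abs_length_coxeter hE.
apply/seteqP; split=> [_ [F /= hF <-]|w [Ww _ wc]].
  have rF := real_exceptional_real hF; have [C [xC cC rC FC]] := hF.
  have rC' : real_seq E C by move=> f /tnthP[i ->].
  have [L [rL sL eL]] := subseq_complement rC' FC.
  rewrite (complete_real_coxeter hE xC cC) in eL.
  have eL' : ((reflection_seq F)^-1 * reflection_seq E)%g = reflection_seq L.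
    by rewrite eL mulgA mulVg mul1g.
  split; first exact: real_seq_Weyl.
    by rewrite /abs_le length1 add0n invg1 mul1g.
  (* The sizes of [F] and its complement [L] add up to n; conversely, shortest factorisations
     concatenate to one of s_E, which has at least n factors. *)
  rewrite /abs_le eL' length_c; apply/eqP; rewrite eqn_leq; apply/andP; split.
    by have := leq_add (abs_length_le rF) (abs_length_le rL); rewrite sL size_tuple.
  have [L1 [r1 <- e1]] := abs_length_attained rF.
  have [L2 [r2 <- e2]] := abs_length_attained rL.
  rewrite -size_cat; apply: (coxeter_factorisation_size hE); first exact: real_cat.
  by rewrite reflection_seq_cat e1 e2 eL.
(* Such factorisations ensure that [abs_length] is a true minimum here, not the default 0. *)
have Weyl_real g : Weyl_group E g -> exists2 L, real_seq E L & reflection_seq L = g.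
  by move=> /Weyl_groupP[u uE <-]; exists u => // f /uE; apply: simple_real.
have Wwc : Weyl_group E (w^-1 * reflection_seq E)%g.
  move: Ww => /Weyl_groupP[u uE <-]; apply/Weyl_groupP; exists (rev u ++ E).
    by move=> f; rewrite mem_cat mem_rev => /orP[/uE|].
  by rewrite reflection_seq_cat reflection_seq_rev.
have [u ru eu] := Weyl_real _ Ww; have [v rv ev] := Weyl_real _ Wwc.
(* Shortest factorisations of w and w^-1 s_E concatenate to n real reflections with product s_E,
   hence to a complete real exceptional sequence with prefix [L1]. *)
have [L1 [r1 s1 e1]] := abs_length_attained ru.
have [L2 [r2 s2 e2]] := abs_length_attained rv.
have r12 := real_cat r1 r2.
have e12 : reflection_seq (L1 ++ L2) = reflection_seq E.
  by rewrite reflection_seq_cat e1 e2 eu ev mulgA mulgV mul1g.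
have s12 : size (L1 ++ L2) == n.
  by apply/eqP; rewrite size_cat s1 s2 eu ev wc.
exists L1; last by rewrite e1 eu.
exists (Tuple s12); split.
- by apply: (coxeter_factorisation_exceptional hE) => //; apply/eqP.
- exact: coxeter_factorisation_complete hE _ _ e12.
- by move=> i; apply/r12/mem_tnth.
- exact: prefix_subseq.
Qed.
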